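(* Let $\mathbb{D}^n_{n+1}=\{d_1,d_2,\dots,d_{n+1}\}$ be a minimal positive basis of $\mathbb{R}^n$. Then $$\gamma_{\mathbf{B}}=\mathring{p}_{\mathbf{B}}$$ for all bases $\mathbf{B}$ of $\mathbb{R}^n$ contained in $\mathbb{D}^n_{n+1}$. Moreover, $$\operatorname{cm}(\mathbb{D}^n_{n+1})=\min_{\mathbf{B}\subset\mathbb{D}^n_{n+1}}\gamma_{\mathbf{B}},$$ where the minimum is over all bases of $\mathbb{R}^n$ contained in $\mathbb{D}^n_{n+1}$.
   Context: The positive span of a finite set $S=\{d_1,\dots,d_s\}\subset\mathbb{R}^n$ is $\operatorname{pspan}(S)=\{\alpha_1d_1+\dots+\alpha_sd_s:\alpha_i\ge 0\}$. $S$ is positively independent if $d_i\notin\operatorname{pspan}(S\setminus\{d_i\})$ for all $i$. A positive basis of $\mathbb{R}^n$ of size $s$ is a positively independent set of $s$ vectors whose positive span is $\mathbb{R}^n$; it is called minimal if $s=n+1$. $\|\cdot\|$ is the Euclidean norm. The cosine measure of a positive basis $\mathbb{D}$ is $\operatorname{cm}(\mathbb{D})=\min_{u\in\mathbb{R}^n,\ \|u\|=1}\ \max_{d\in\mathbb{D}}\frac{u^\top d}{\|d\|}$. For a positive basis $\mathbb{D}=\{d_1,\dots,d_s\}$ put $\hat d_i=d_i/\|d_i\|$. For a basis of $\mathbb{R}^n$ consisting of $n$ linearly independent vectors $d_{i_1},\dots,d_{i_n}$ of $\mathbb{D}$, let $\mathbf{B}$ be the $n\times n$ matrix with columns $\hat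 d_{i_1},\dots,\hat d_{i_n}$, let $\mathbf{G}(\mathbf{B})=\mathbf{B}^\top\mathbf{B}$, let $\mathbf{1}\in\mathbb{R}^n$ be the all-ones vector, and define $$\gamma_{\mathbf{B}}=\frac{1}{\sqrt{\mathbf{1}^\top\mathbf{G}(\mathbf{B})^{-1}\mathbf{1}}},\qquad u_{\mathbf{B}}=\gamma_{\mathbf{B}}\,\mathbf{B}^{-\top}\mathbf{1},\qquad \mathring{p}_{\mathbf{B}}=\max_{1\le i\le s}u_{\mathbf{B}}^\top\hat d_i .$$ *)

(* Defs.v *)
From HB Require Import structures.
From mathcomp Require Export all_boot all_order all_algebra.
From mathcomp Require Export classical_sets reals.

Set Implicit Arguments.
Unset Strict Implicit.
Unset Printing Implicit Defensive.

Import Order.TTheory GRing.Theory Num.Theory.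
Local Open Scope classical_set_scope.
Local Open Scope ring_scope.

Definition dotv (R : realType) (n : nat) (u v : 'cV[R]_n) : R :=
  (u^T *m v) 0 0.

(* The library norm `|v| on matrices is the sup norm, hence this definition. *)
Definition enorm (R : realType) (n : nat) (v : 'cV[R]_n) : R :=
  Num.sqrt (dotv v v).

Definition is_min (R : realType) (A : set R) (m : R) : Prop :=
  A m /\ lbound A m.

(* A minimum is unique when it exists; the value 0 is used only for sets
   without a minimum. *)
Definition setmin (R : realType) (A : set R) : R := xget 0 (is_min A).

(* The maximum of the nonempty finite family F; F ord0 is the initial value
   because R has no least element. *)
Definition famax (R : realType) (s : nat) (F : 'I_s.+1 -> R) : R :=
  \big[Num.max/F ord0]_(i < s.+1) F i.

(* Positive span of the subfamily of the d i with P i. *)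
Definition pspan (R : realType) (n s : nat) (d : 'I_s -> 'cV[R]_n)
    (P : pred 'I_s) : set 'cV[R]_n :=
  [set v | exists a : 'I_s -> R,
     (forall i, 0 <= a i) /\ v = \sum_(i < s | P i) a i *: d i].

Definition positively_independent (R : realType) (n s : nat)
    (d : 'I_s -> 'cV[R]_n) : Prop :=
  forall i, ~ pspan d (predC1 i) (d i).

(* A set of s vectors is enumerated by an injective family over 'I_s. *)
Definition positive_basis (R : realType) (n s : nat)
    (d : 'I_s -> 'cV[R]_n) : Prop :=
  [/\ injective d, positively_independent d & pspan d predT = setT].

Definition minimal_positive_basis (R : realType) (n : nat)
    (d : 'I_n.+1 -> 'cV[R]_n) : Prop :=
  positive_basis d.

Definition cm (R : realType) (n s : nat) (d : 'I_s.+1 -> 'cV[R]_n) : R :=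
  setmin [set famax (fun i => dotv u (d i) / enorm (d i))
         | u in [set u : 'cV[R]_n | enorm u = 1]].

Definition normalized (R : realType) (n s : nat) (d : 'I_s -> 'cV[R]_n)
    (i : 'I_s) : 'cV[R]_n :=
  (enorm (d i))^-1 *: d i.

(* A basis of R^n contained in d is given by the indices f 0, ..., f (n - 1)
   of its vectors, in any order. *)
Definition is_subbasis (R : realType) (n s : nat) (d : 'I_s -> 'cV[R]_n)
    (f : 'I_n -> 'I_s) : Prop :=
  basis_of fullv [seq d (f k) | k : 'I_n].

Definition basis_mx (R : realType) (n s : nat) (d : 'I_s -> 'cV[R]_n)
    (f : 'I_n -> 'I_s) : 'M[R]_n :=
  \matrix_(i, k) normalized d (f k) i 0.

Definition gram (R : realType) (n : nat) (B : 'M[R]_n) : 'M[R]_n := B^T *m B.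

Definition onesv (R : realType) (n : nat) : 'cV[R]_n := const_mx 1.

Definition gammaB (R : realType) (n : nat) (B : 'M[R]_n) : R :=
  1 / Num.sqrt (((onesv R n)^T *m invmx (gram B) *m onesv R n) 0 0).

Definition uB (R : realType) (n : nat) (B : 'M[R]_n) : 'cV[R]_n :=
  gammaB B *: ((invmx B)^T *m onesv R n).

Definition pB (R : realType) (n s : nat) (d : 'I_s.+1 -> 'cV[R]_n)
    (B : 'M[R]_n) : R :=
  famax (fun i => dotv (uB B) (normalized d i)).

(* Main.v *)
(* With unit vectors h_i = d_i / |d_i| there is a relation sum_i c_i h_i = 0
   with all c_i > 0.  For a subbasis with matrix B, the vector w = B^{-T} 1
   satisfies w . h_i = 1 on the basis; by the relation w . h_j < 0 at the
   omitted index j, so u_B = w / |w| attains its maximum gamma_B = 1 / |w| on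
   the basis.  If u is a unit vector with maximum p > 0, then u / p lies in the
   simplex {v | v . h_i <= 1 for all i}, whose vertices are the vectors w_j
   (index j omitted).  Hence 1 / p <= |w_j|, i.e. gamma_j <= p, for some j. *)
Require Import Defs.
From mathcomp Require Import all_boot all_order all_algebra.
From mathcomp Require Import classical_sets reals.
From mathcomp Require Import ring lra.

Import Order.TTheory GRing.Theory Num.Theory.
Local Open Scope classical_set_scope.
Local Open Scope ring_scope.

(** * Euclidean inner product and norm *)

Lemma dotvC {R : realType} {n : nat} (u v : 'cV[R]_n) : dotv u v = dotv v u.
Proof. by rewrite /dotv -[in LHS](trmxK v) -trmx_mul mxE. Qed.

Lemma dotvZr {R : realType} {n : nat} a (u v : 'cV[R]_n) :
  dotv u (a *: v) = a * dotv u v.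
Proof. by rewrite /dotv -scalemxAr mxE. Qed.

Lemma dotvZl {R : realType} {n : nat} a (u v : 'cV[R]_n) :
  dotv (a *: u) v = a * dotv u v.
Proof. by rewrite dotvC dotvZr dotvC. Qed.

Lemma dotvBr {R : realType} {n : nat} (u v w : 'cV[R]_n) :
  dotv u (v - w) = dotv u v - dotv u w.
Proof. by rewrite /dotv mulmxBr !mxE. Qed.

Lemma dotvBl {R : realType} {n : nat} (u v w : 'cV[R]_n) :
  dotv (u - v) w = dotv u w - dotv v w.
Proof. by rewrite dotvC dotvBr !(dotvC w). Qed.

Lemma dotv_sumr {R : realType} {n : nat} (I : Type) (r : seq I) (P : pred I)
    (F : I -> 'cV[R]_n) u :
  dotv u (\sum_(i <- r | P i) F i) = \sum_(i <- r | P i) dotv u (F i).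
Proof. by rewrite /dotv mulmx_sumr summxE. Qed.

Lemma dotv_suml {R : realType} {n : nat} (I : Type) (r : seq I) (P : pred I)
    (F : I -> 'cV[R]_n) u :
  dotv (\sum_(i <- r | P i) F i) u = \sum_(i <- r | P i) dotv (F i) u.
Proof. by rewrite dotvC dotv_sumr; apply: eq_bigr => i _; rewrite dotvC. Qed.

Lemma dotv0 {R : realType} {n : nat} (u : 'cV[R]_n) : dotv u 0 = 0.
Proof. by rewrite /dotv mulmx0 mxE. Qed.

Lemma dotvvE {R : realType} {n : nat} (v : 'cV[R]_n) :
  dotv v v = \sum_i v i 0 ^+ 2.
Proof. by rewrite /dotv mxE; apply: eq_bigr => i _; rewrite mxE. Qed.

Lemma dotv_ge0 {R : realType} {n : nat} (v : 'cV[R]_n) : 0 <= dotv v v.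
Proof. by rewrite dotvvE sumr_ge0 // => i _; exact: sqr_ge0. Qed.

Lemma dotv_eq0 {R : realType} {n : nat} (v : 'cV[R]_n) :
  dotv v v = 0 -> v = 0.
Proof.
rewrite dotvvE => /psumr_eq0P v0; apply/colP => i; rewrite mxE.
by apply/eqP; rewrite -sqrf_eq0 v0 // => j _; exact: sqr_ge0.
Qed.

Lemma dotv_gt0 {R : realType} {n : nat} (v : 'cV[R]_n) : v != 0 -> 0 < dotv v v.
Proof.
move=> v0; rewrite lt_neqAle dotv_ge0 andbT eq_sym.
by apply: contra v0 => /eqP/dotv_eq0 ->.
Qed.

Lemma enorm_gt0 {R : realType} {n : nat} (v : 'cV[R]_n) : v != 0 -> 0 < enorm v.
Proof. by move=> v0; rewrite /enorm sqrtr_gt0 dotv_gt0. Qed.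

Lemma enorm_scale {R : realType} {n : nat} (a : R) (v : 'cV[R]_n) :
  0 <= a -> enorm (a *: v) = a * enorm v.
Proof.
move=> a0; rewrite /enorm dotvZl dotvZr mulrA -expr2 sqrtrM ?sqr_ge0 //.
by rewrite sqrtr_sqr ger0_norm.
Qed.

(** * Maxima of finite families and minima of sets *)

Lemma famax_ge {R : realType} {s : nat} (F : 'I_s.+1 -> R) i : F i <= famax F.
Proof. by rewrite /famax; exact: le_bigmax. Qed.

Lemma famax_eq {R : realType} {s : nat} (F : 'I_s.+1 -> R) m k :
  F k = m -> (forall i, F i <= m) -> famax F = m.
Proof.
move=> Fk Fm; apply: le_anti; rewrite -{2}Fk famax_ge andbT.
by apply: bigmax_le => // i _; exact: Fm.
Qed.

Lemma setmin_eq {R : realType} {A : set R} {m : R} :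
  is_min A m -> setmin A = m.
Proof.
move=> [Am lm]; apply: xget_unique => // y [Ay ly].
by apply: le_anti; rewrite ly // lm.
Qed.

(** * Positive spanning families *)

Lemma positively_independent_neq0 {R : realType} {n s : nat}
    {d : 'I_s -> 'cV[R]_n} : positively_independent d -> forall i, d i != 0.
Proof.
move=> hi i; apply/eqP => di; apply: (hi i); exists (fun=> 0); split => //.
by rewrite big1 // => j _; rewrite scale0r.
Qed.

(** Expand [- \sum_i d i] with coefficients [a i >= 0]; moving it across leaves the coefficients
    [1 + a i > 0]. *)
Lemma pspan_positive_relation {R : realType} {n s : nat}
    {d : 'I_s -> 'cV[R]_n} :
  pspan d predT = setT ->
  exists2 c : 'I_s -> R, forall i, 0 < c i & \sum_i c i *: d i = 0.
Proof.
move=> dT; have : pspan d predT (- \sum_i d i) by rewrite dT.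
move=> [a [a0 ha]]; exists (fun i => 1 + a i).
  by move=> i; rewrite ltr_pwDl.
under eq_bigr => i _ do rewrite scalerDl scale1r.
by rewrite big_split /= -ha subrr.
Qed.

Lemma pspan_dotv_eq0 {R : realType} {n s : nat} {d : 'I_s -> 'cV[R]_n} :
  pspan d predT = setT ->
  forall x, (forall i, dotv x (d i) = 0) -> x = 0.
Proof.
move=> dT x xd; have : pspan d predT x by rewrite dT.
move=> [a [_ xE]]; apply: dotv_eq0; rewrite {2}xE dotv_sumr big1 // => i _.
by rewrite dotvZr xd mulr0.
Qed.

Lemma dotv_normalized {R : realType} {n s : nat} (d : 'I_s -> 'cV[R]_n) u i :
  dotv u (normalized d i) = dotv u (d i) / enorm (d i).
Proof. by rewrite /normalized dotvZr mulrC. Qed.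

(** * Bases contained in the family *)

Lemma subbasis_dotv_eq0 {R : realType} {n s : nat} {d : 'I_s -> 'cV[R]_n}
    {f : 'I_n -> 'I_s} : is_subbasis d f ->
  forall x, (forall k, dotv x (d (f k)) = 0) -> x = 0.
Proof.
move=> /andP[/eqP sp _] x xd; apply: dotv_eq0.
have xs : x \in <<in_tuple [seq d (f k) | k : 'I_n]>>%VS by rewrite sp memvf.
rewrite {2}(coord_span xs) dotv_sumr big1 // => i _.
have /mapP[k _ ->] : (in_tuple [seq d (f k) | k : 'I_n])`_i \in
    [seq d (f k) | k : 'I_n] by apply: mem_nth; exact: ltn_ord.
by rewrite dotvZr xd mulr0.
Qed.

Lemma subbasis_inj {R : realType} {n s : nat} {d : 'I_s -> 'cV[R]_n}
    {f : 'I_n -> 'I_s} : is_subbasis d f -> injective f.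
Proof.
by move=> /andP[_ /free_uniq/injectiveP dI] i j fij; apply: dI; rewrite fij.
Qed.

(** The positive relation can be solved for [d j], so the other [n] vectors already span; by
    dimension they form a basis. *)
Lemma subbasis_lift {R : realType} {n : nat} {d : 'I_n.+1 -> 'cV[R]_n} :
  pspan d predT = setT -> forall j : 'I_n.+1, is_subbasis d (lift j).
Proof.
move=> dT j; have [c c0 hc] := pspan_positive_relation dT.
rewrite /is_subbasis basisEdim size_map -cardE card_ord.
rewrite dimvf dim_matrix mulr1 leqnn andbT; apply/subvP => x _.
set V := (X in x \in X).
have dV i : i != j -> d i \in V.
  rewrite eq_sym => /unlift_some[k -> _]; apply: memv_span.
  by apply/mapP; exists k; rewrite ?mem_enum.
have djV : d j \in V.
  move/eqP: hc; rewrite (bigD1 j) //= addr_eq0 => /eqP hj.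
  rewrite -(scalerK (lt0r_neq0 (c0 j)) (d j)) hj memvZ // memvN.
  by apply: memv_suml => i ij; apply: memvZ; exact: dV.
have : pspan d predT x by rewrite dT.
move=> [a [_ ->]]; apply: memv_suml => i _; apply: memvZ.
by have [->|/dV] := eqVneq i j.
Qed.

Lemma normalized_pspan {R : realType} {n s : nat} {d : 'I_s -> 'cV[R]_n} :
  (forall i, d i != 0) -> pspan d predT = setT ->
  pspan (normalized d) predT = setT.
Proof.
move=> d0 dT; apply/seteqP; split => // x _.
have : pspan d predT x by rewrite dT.
move=> [a [a0 ->]]; exists (fun i => a i * enorm (d i)); split.
  by move=> i; rewrite mulr_ge0 // sqrtr_ge0.
apply: eq_bigr => i _.
by rewrite /normalized scalerA mulfK // gt_eqF // enorm_gt0.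
Qed.

(** A row vector killed by the matrix is orthogonal to every vector of the subbasis, hence zero. *)
Lemma basis_mx_unit {R : realType} {n s : nat} {d : 'I_s -> 'cV[R]_n}
    {f : 'I_n -> 'I_s} :
  (forall i, d i != 0) -> is_subbasis d f -> basis_mx d f \in unitmx.
Proof.
move=> d0 bf; rewrite -row_free_unit; apply: inj_row_free => v vB.
apply: trmx_inj; rewrite trmx0; apply: (subbasis_dotv_eq0 bf) => k.
have /eqP : dotv v^T (normalized d (f k)) = 0.
  move/rowP/(_ k): vB; rewrite /dotv trmxK !mxE => vB; rewrite -[RHS]vB.
  by apply: eq_bigr => i _; rewrite [basis_mx _ _ _ _]mxE.
rewrite dotv_normalized mulf_eq0 invr_eq0 (gt_eqF (enorm_gt0 _ (d0 _))) orbF.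
by move/eqP.
Qed.

(** * The vector [B^{-T} 1] and its norm *)

(** The vector [w] of the proof idea: [uB B] before scaling, normal to the hyperplane through the
    columns of [B]. *)
Definition dual_ones {R : realType} {n : nat} (B : 'M[R]_n) : 'cV[R]_n :=
  (invmx B)^T *m onesv R n.

Lemma dotv_dual_ones {R : realType} {n s : nat} {d : 'I_s -> 'cV[R]_n}
    {f : 'I_n -> 'I_s} : basis_mx d f \in unitmx ->
  forall k, dotv (dual_ones (basis_mx d f)) (normalized d (f k)) = 1.
Proof.
move=> uB k; have -> : normalized d (f k) = col k (basis_mx d f).
  by apply/colP => i; rewrite !mxE.
rewrite /dotv /dual_ones trmx_mul trmxK colE mulmxA.
by rewrite mulmxKV // -colE !mxE.
Qed.

Lemma dual_ones_neq0 {R : realType} {n : nat} {B : 'M[R]_n} :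
  (0 < n)%N -> B \in unitmx -> dual_ones B != 0.
Proof.
move=> n0 uB; apply/eqP => /(congr1 (mulmx B^T)).
rewrite mulmx0 /dual_ones mulmxA -trmx_mul mulVmx // trmx1 mul1mx.
by move/colP/(_ (Ordinal n0)); rewrite !mxE => /eqP; rewrite oner_eq0.
Qed.

(** Since [G^{-1} = B^{-1} B^{-T}], the quadratic form [1^T G^{-1} 1] is the squared norm of
    [B^{-T} 1]. *)
Lemma gammaBE {R : realType} {n : nat} {B : 'M[R]_n} :
  B \in unitmx -> gammaB B = (enorm (dual_ones B))^-1.
Proof.
move=> uB; rewrite /gammaB div1r /enorm /dotv /dual_ones trmx_mul trmxK.
suff -> : invmx (gram B) = invmx B *m (invmx B)^T by rewrite !mulmxA.
have uG : gram B \in unitmx by rewrite /gram unitmx_mul unitmx_tr uB.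
apply: (can_inj (mulKmx uG)).
rewrite mulmxV // /gram mulmxA -(mulmxA B^T) mulmxV // mulmx1.
by rewrite -trmx_mul mulVmx // trmx1.
Qed.

(** * The simplex with vertices [w j] *)

(** Pair the relation with [w]: each index [i != j] contributes exactly [c i]. *)
Lemma dotv_opposite {R : realType} {n s : nat} {h : 'I_s -> 'cV[R]_n}
    {c : 'I_s -> R} {w j} :
  \sum_i c i *: h i = 0 -> (forall i, i != j -> dotv w (h i) = 1) ->
  c j * dotv w (h j) = c j - \sum_i c i.
Proof.
move=> hc w1; move/(congr1 (dotv w)): hc.
rewrite dotv0 dotv_sumr (bigD1 j) //= dotvZr [X in c j - X](bigD1 j) //=.
rewrite (eq_bigr c) => [/eqP|i ij]; last by rewrite dotvZr w1 // mulr1.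
by rewrite addr_eq0 => /eqP ->; rewrite opprD addrA subrr add0r.
Qed.

(* [l j] is the gap [1 - v . h_j] to the facet opposite to [w j], divided by
   the gap [(sum_i c_i) / c_j] of [w j] itself. *)
Lemma simplex_barycentric {R : realType} {n s : nat} {h : 'I_s -> 'cV[R]_n}
    {c : 'I_s -> R} {w : 'I_s -> 'cV[R]_n} :
  (forall x, (forall i, dotv x (h i) = 0) -> x = 0) ->
  \sum_i c i *: h i = 0 -> \sum_i c i != 0 ->
  (forall j i, i != j -> dotv (w j) (h i) = 1) ->
  forall v, let l j := (1 - dotv v (h j)) * c j / \sum_i c i in
  \sum_j l j = 1 /\ v = \sum_j l j *: w j.
Proof.
move=> hsp hc C0 hw v l.
have l1 : \sum_j l j = 1.
  rewrite -mulr_suml; under eq_bigr => j _ do rewrite mulrBl mul1r.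
  have S : \sum_j dotv v (h j) * c j = dotv v 0.
    by rewrite -hc dotv_sumr; apply: eq_bigr => i _; rewrite dotvZr mulrC.
  by rewrite sumrB S dotv0 subr0 divff.
(* Only the zero vector is orthogonal to all [h i], so the expansion is tested against each
   [h i]. *)
split => //; apply/eqP; rewrite -subr_eq0; apply/eqP/hsp => i.
rewrite dotvBl dotv_suml (bigD1 i) //= dotvZl.
rewrite (eq_bigr l) => [|j ji]; last by rewrite dotvZl hw ?mulr1 // eq_sym.
have -> : \sum_(j | j != i) l j = 1 - l i.
  by rewrite -l1 (bigD1 i (erefl true)) addrAC subrr add0r.
(* The weight [l i] scales the gap of [w i] at facet [i] to the gap of [v]. *)
have -> : l i * dotv (w i) (h i) = l i - (1 - dotv v (h i)).
  have := dotv_opposite hc (hw i); rewrite /l.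
  move: (dotv v _) (dotv _ _) (c i) (\sum_i c i) C0 => a t b C C0 bt.
  have -> : (1 - a) * b / C * t = (1 - a) * (b * t) / C by ring.
  by rewrite bt; field.
by ring.
Qed.

(** If every [w j] were shorter than [v], each [v . v - w j . v] would be positive; their average
    with weights [l j] is 0, so all weights would vanish. *)
Lemma convex_combination_norm {R : realType} {n s : nat}
    {w : 'I_s -> 'cV[R]_n} {l : 'I_s -> R} {v} :
  (forall j, 0 <= l j) -> \sum_j l j = 1 -> v = \sum_j l j *: w j ->
  exists j, dotv v v <= dotv (w j) (w j).
Proof.
move=> l0 l1 vE.
case: (boolP [exists j, dotv v v <= dotv (w j) (w j)]) => [/existsP //|].
rewrite negb_exists => /forallP wv.
(* Expanding [|w j - v|^2 >= 0] gives [2 (w j . v) <= |w j|^2 + |v|^2 < 2 |v|^2]. *)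
have pos j : 0 < dotv v v - dotv (w j) v.
  have := dotv_ge0 (w j - v); rewrite dotvBr !dotvBl (dotvC v (w j)).
  by move: (wv j); rewrite -ltNge; lra.
have S : \sum_j l j * (dotv v v - dotv (w j) v) = 0.
  under eq_bigr => j _ do rewrite mulrBr -(dotvZl _ (w j)).
  by rewrite sumrB -mulr_suml l1 mul1r -dotv_suml -vE subrr.
have /psumr_eq0P S0 j : true -> 0 <= l j * (dotv v v - dotv (w j) v).
  by move=> _; rewrite mulr_ge0 // ltW.
move/eqP: l1; rewrite big1 ?(eq_sym 0) ?oner_eq0 // => j _.
have /eqP := S0 S j isT.
by rewrite mulf_eq0 (gt_eqF (pos j)) orbF => /eqP.
Qed.

(** * Minimal positive bases and the cosine measure *)

(** Counting: the image of the injective [f] lies in the complement of [j], and both have [n]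
    elements. *)
Lemma subbasis_omitted {R : realType} {n : nat} {d : 'I_n.+1 -> 'cV[R]_n}
    {f : 'I_n -> 'I_n.+1} {j} : is_subbasis d f -> j \notin codom f ->
  forall i, i != j -> exists k, i = f k.
Proof.
move=> /subbasis_inj fI jf i ij.
have sub : codom f \subset predC1 j.
  by apply/fintype.subsetP => x xf; rewrite inE; apply: contra jf => /eqP <-.
have : codom f =i predC1 j.
  by apply/subset_cardP => //; rewrite card_codom // cardC1 !card_ord.
by move/(_ i); rewrite !inE ij => /codomP.
Qed.

Lemma gammaB_eq_pB {R : realType} {n : nat} {d : 'I_n.+1 -> 'cV[R]_n} :
  (0 < n)%N -> (forall i, d i != 0) -> pspan d predT = setT ->
  forall f, is_subbasis d f -> gammaB (basis_mx d f) = pB d (basis_mx d f).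
Proof.
move=> n0 d0 dT f bf; have uB := basis_mx_unit d0 bf.
have w1 := dotv_dual_ones uB; set w := dual_ones _ in w1.
have g0 : 0 < gammaB (basis_mx d f).
  by rewrite gammaBE // invr_gt0 enorm_gt0 // dual_ones_neq0.
have [c c0 hc] := pspan_positive_relation (normalized_pspan d0 dT).
symmetry; apply: (@famax_eq _ _ _ _ (f (Ordinal n0))).
  by rewrite dotvZl w1 mulr1.
move=> i; rewrite dotvZl (ler_piMr (ltW g0)) //.
have [/codomP[k ->]|fi] := boolP (i \in codom f); first by rewrite w1.
have hw j : j != i -> dotv w (normalized d j) = 1.
  by move=> /(subbasis_omitted bf fi)[k ->].
(* At the omitted index, multiplying by [c i > 0] turns the claim into [c i - \sum_j c j <= c i]. *)
rewrite -(ler_pM2l (c0 i)) (dotv_opposite hc hw) mulr1 gerBl.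
by apply: sumr_ge0 => j _; exact: ltW.
Qed.

(** This is the lower bound for the cosine measure, obtained from the farthest vertex of the simplex
    containing [u / p]. *)
Lemma gammaB_le_famax {R : realType} {n : nat} {d : 'I_n.+1 -> 'cV[R]_n} :
  (0 < n)%N -> (forall i, d i != 0) -> pspan d predT = setT ->
  forall u, enorm u = 1 ->
  exists j : 'I_n.+1, gammaB (basis_mx d (lift j)) <=
            famax (fun i => dotv u (normalized d i)).
Proof.
move=> n0 d0 dT u u1.
have hT := normalized_pspan d0 dT.
have hsp := pspan_dotv_eq0 hT.
have [c c0 hc] := pspan_positive_relation hT.
set p := famax _.
have up i : dotv u (normalized d i) <= p.
  by exact: (famax_ge (fun i => dotv u (normalized d i))).
(* If [p <= 0], no [u . h_i] is positive while their sum weighted by [c i > 0] is 0; all vanish and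
   [u = 0]. *)
have p0 : 0 < p.
  rewrite ltNge; apply/negP => pn.
  have un i : dotv u (normalized d i) <= 0 := le_trans (up i) pn.
  suff uz : u = 0.
    by move/eqP: u1; rewrite uz /enorm dotv0 sqrtr0 eq_sym oner_eq0.
  apply: hsp => i.
  have S : \sum_i - (c i * dotv u (normalized d i)) = 0.
    under eq_bigr => k _ do rewrite -dotvZr.
    by rewrite sumrN -dotv_sumr hc dotv0 oppr0.
  have /psumr_eq0P/(_ S i isT)/eqP : forall i, true ->
      0 <= - (c i * dotv u (normalized d i)).
    by move=> k _; rewrite oppr_ge0 pmulr_rle0.
  by rewrite oppr_eq0 mulf_eq0 (gt_eqF (c0 i)) => /eqP.
have C0 : 0 < \sum_i c i.
  rewrite (bigD1 ord0) //= ltr_wpDr //.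
  by apply: sumr_ge0 => i _; exact: ltW.
pose w (j : 'I_n.+1) := dual_ones (basis_mx d (lift j)).
have uB (j : 'I_n.+1) : basis_mx d (lift j) \in unitmx.
  by apply: basis_mx_unit => //; exact: subbasis_lift.
have hw j i : i != j -> dotv (w j) (normalized d i) = 1.
  by rewrite eq_sym => /unlift_some[k -> _]; exact: dotv_dual_ones.
have /= [l1 vE] := simplex_barycentric hsp hc (lt0r_neq0 C0) hw (p^-1 *: u).
have [|j vj] := convex_combination_norm _ l1 vE.
  (* The weight at [j] is nonnegative because [u . h_j <= p]. *)
  move=> j; rewrite divr_ge0 ?(ltW C0) // mulr_ge0 ?(ltW (c0 _)) //.
  by rewrite dotvZl subr_ge0 ler_pdivrMl // mulr1.
(* Inverting, the goal becomes [1 / p <= |w j|], where [1 / p] is the norm of [u / p]. *)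
exists j; rewrite gammaBE // invf_ple ?posrE ?enorm_gt0 ?dual_ones_neq0 //.
have := ler_wsqrtr vj; rewrite -!/(enorm _) enorm_scale ?u1 ?mulr1 //.
by rewrite invr_ge0 ltW.
Qed.

(** In dimension 0 the only vector is zero, which positive independence excludes. *)
Lemma minimal_positive_basis_dim_gt0 {R : realType} {n : nat}
    {d : 'I_n.+1 -> 'cV[R]_n} : minimal_positive_basis d -> (0 < n)%N.
Proof.
case=> _ /positively_independent_neq0/(_ ord0); case: n d => // d /eqP[].
by apply/colP => -[].
Qed.

Theorem theorem21 (R : realType) (n : nat) (d : 'I_n.+1 -> 'cV[R]_n)
    (hd : minimal_positive_basis d) :
  (forall f : 'I_n -> 'I_n.+1, is_subbasis d f ->
     gammaB (basis_mx d f) = pB d (basis_mx d f)) /\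
  is_min [set gammaB (basis_mx d f) | f in [set f | is_subbasis d f]] (cm d).
Proof.
have n0 := minimal_positive_basis_dim_gt0 hd.
have [_ /positively_independent_neq0 d0 dT] := hd.
have gp := gammaB_eq_pB n0 d0 dT.
split => //.
pose A := [set famax (fun i => dotv u (d i) / enorm (d i))
          | u in [set u : 'cV[R]_n | enorm u = 1]].
have AE (u : 'cV[R]_n) : famax (fun i => dotv u (d i) / enorm (d i)) =
    famax (fun i => dotv u (normalized d i)).
  (* This rewrite treats the initial value of the maximum, the next line its terms. *)
  rewrite /famax dotv_normalized.
  by apply: eq_bigr => i _; rewrite dotv_normalized.
(* The unit vector [u_B] attains [p_B], which equals [gamma_B]. *)
have gA f : is_subbasis d f -> A (gammaB (basis_mx d f)).
  move=> bf; have uB := basis_mx_unit d0 bf.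
  exists (Defs.uB (basis_mx d f)) => /=; last by rewrite AE gp.
  have w0 := enorm_gt0 _ (dual_ones_neq0 n0 uB).
  rewrite /Defs.uB -/(dual_ones _) enorm_scale gammaBE //.
    by rewrite mulVf // gt_eqF.
  by rewrite invr_ge0 ltW.
pose g (j : 'I_n.+1) := gammaB (basis_mx d (lift j)).
(* Choose the omitted index with the least [gamma]; its value bounds [A] from below and belongs to
   [A]. *)
case: (@arg_minP _ _ _ (ord0 : 'I_n.+1) xpredT g isT) => j _ gj.
have bj := subbasis_lift dT j.
have lA : lbound A (g j).
  move=> _ [u /= u1 <-]; rewrite AE.
  have [k gk] := gammaB_le_famax n0 d0 dT u u1.
  exact: le_trans (gj k isT) gk.
have -> : cm d = g j by apply: setmin_eq; split => //; exact: gA.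
split; first by exists (lift j).
(* A subbasis listed in any order also has its [gamma] in [A], so the bound on [A] covers it. *)
by move=> _ [f /= bf <-]; apply: lA; exact: gA.
Qed.
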